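(* Let $a_0,a_1,\dots,a_n$ be a sequence of nonzero real numbers. If $\{a_i\}$ is log-convex, then the sequence $\left\{\frac{1}{a_i}\right\}$ is log-concave.
   Context: A sequence of real numbers $a_0,a_1,\dots,a_n$ is called log-convex if $a_i^2\le a_{i-1}a_{i+1}$ for all $i$ with $1\le i\le n-1$, and log-concave if $a_i^2\ge a_{i-1}a_{i+1}$ for all $i$ with $1\le i\le n-1$. *)

(* Defs.v *)
From mathcomp Require Import all_boot all_order all_algebra.
From mathcomp Require Import reals.

Set Implicit Arguments.
Unset Strict Implicit.
Unset Printing Implicit Defensive.

Import Order.TTheory GRing.Theory Num.Theory.
Local Open Scope ring_scope.

(* A finite sequence a_0, ..., a_n is given by n and a function on nat, of
   which only the values at 0, ..., n matter. When n <= 1 the range of i is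
   empty; in particular the truncation 0 - 1 = 0 is harmless. *)
Definition log_convex (R : realType) (n : nat) (a : nat -> R) : Prop :=
  forall i : nat, (1 <= i <= n - 1)%N -> a i ^+ 2 <= a (i - 1)%N * a (i + 1)%N.

Definition log_concave (R : realType) (n : nat) (a : nat -> R) : Prop :=
  forall i : nat, (1 <= i <= n - 1)%N -> a i ^+ 2 >= a (i - 1)%N * a (i + 1)%N.

(* Main.v *)
Require Import Defs.
From mathcomp Require Import all_boot all_order all_algebra.
From mathcomp Require Import reals.

Set Implicit Arguments.
Unset Strict Implicit.
Unset Printing Implicit Defensive.

Import Order.TTheory GRing.Theory Num.Theory.
Local Open Scope ring_scope.

(** Inversion reverses inequalities between positive numbers, so inverting the log-convexity
    inequality gives the claim. No sign is assumed on the terms: a nonzero [a i] has a positive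
    square, and only products are compared. *)

Theorem lemma1 (R : realType) (n : nat) (a : nat -> R)
    (a_neq0 : forall i : nat, (i <= n)%N -> a i != 0)
    (a_log_convex : log_convex n a) :
  log_concave n (fun i : nat => 1 / a i).
Proof.
move=> i Hi; have le_i_n : (i <= n)%N.
  by case/andP: Hi => _ /leq_trans; apply; apply: leq_subr.
have sqr_gt0 : 0 < a i ^+ 2 by rewrite exprn_even_gt0 // a_neq0.
have le_sqr_prod := a_log_convex i Hi.
rewrite !div1r exprVn -invfM lef_pV2 // posrE //.
(* What remains is positivity of the product of the two neighbours: log-convexity itself bounds it
   below by the positive [a i ^+ 2]. *)
exact: lt_le_trans le_sqr_prod.
Qed.
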